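(* Let $d,m,n\in\mathbb{N}$ and let $\mathcal F=\{f_1,\dots,f_n\}$ be an affine GIFS of order $m$ on $\mathbb{R}^d$, i.e. a GIFS of order $m$ on the Euclidean space $\mathbb{R}^d$ in which each $f_i:(\mathbb{R}^d)^m\to\mathbb{R}^d$ has the form $$f_i(x_1,\dots,x_m)=A^i_1\cdot x_1+\dots+A^i_m\cdot x_m+B^i,\qquad x_1,\dots,x_m\in\mathbb{R}^d,$$ where $A^i_1,\dots,A^i_m$ are real $d\times d$ matrices and $B^i\in\mathbb{R}^d$ (elements of $\mathbb{R}^d$ are column vectors). Put $X=\mathbb{R}^d$. Then for every $k\in\mathbb{N}$, every $\alpha=(\alpha^1,\dots,\alpha^k)\in{}_k\Omega$ and every $x\in X_k$ (all indices $\epsilon_j$ below range over $\{1,\dots,m\}$), $$f_\alpha(x)=\sum_{\epsilon_1,\epsilon_2,\dots,\epsilon_k}A^{\alpha^1}_{\epsilon_1}\cdot A^{\alpha^2_{(\epsilon_1)}}_{\epsilon_2}\cdot\ldots\cdot A^{\alpha^k_{(\epsilon_1,\epsilon_2,\dots,\epsilon_{k-1})}}_{\epsilon_k}\cdot x_{(\epsilon_1,\epsilon_2,\dots,\epsilon_k)}+B^\alpha,$$ where $$B^\alpha:=B^{\alpha^1}+\sum_{\epsilon_1}A^{\alpha^1}_{\epsilon_1}\cdot B^{\alpha^2_{(\epsilon_1)}}+\dots+\sum_{\epsilon_1,\epsilon_2,\dots,\epsilon_{k-1}}A^{\alpha^1}_{\epsilon_1}\cdot A^{\alpha^2_{(\epsilon_1)}}_{\epsilon_2}\cdot\ldots\cdot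 A^{\alpha^{k-1}_{(\epsilon_1,\epsilon_2,\dots,\epsilon_{k-2})}}_{\epsilon_{k-1}}\cdot B^{\alpha^k_{(\epsilon_1,\epsilon_2,\dots,\epsilon_{k-1})}}.$$
   Context: $\mathbb{N}=\{1,2,3,\dots\}$. For a metric space $(X,d)$ and $m\in\mathbb{N}$, $X^m$ carries the maximum metric $d_m((x_1,\dots,x_m),(y_1,\dots,y_m))=\max_i d(x_i,y_i)$. A map $f:X^m\to X$ is a generalized Matkowski contraction (of order $m$) if there is a nondecreasing $\varphi:[0,\infty)\to[0,\infty)$ such that for every $t>0$ the iterates satisfy $\varphi^{(k)}(t)\to0$ as $k\to\infty$, and $d(f(x),f(y))\le\varphi(d_m(x,y))$ for all $x,y\in X^m$. A GIFS of order $m$ on $X$ is a finite family $\mathcal F=\{f_1,\dots,f_n\}$ of generalized Matkowski contractions of order $m$. Code spaces. $\Omega_1:=\{1,\dots,n\}$, $\Omega_{k+1}:=\Omega_k\times\dots\times\Omega_k$ ($m$ factors), and ${}_k\Omega:=\Omega_1\times\Omega_2\times\dots\times\Omega_k$. An element of ${}_k\Omega$ is written $\alpha=(\alpha^1,\dots,\alpha^k)$ with $\alpha^i\in\Omega_i$, and for $i\ge2$, $\alpha^i=(\alpha^i_1,\dots,\alpha^i_m)$ with $\alpha^i_j\in\Omega_{i-1}$. For $k\ge2$, $\alpha\in{}_k\Omega$ and $i\in\{1,\dots,m\}$, $\alpha(i):=(\alpha^2_i,\alpha^3_i,\dots,\alpha^k_i)\in{}_{k-1}\Omega$. Spaces $X_k$.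 $X_1:=X\times\dots\times X$ ($m$ factors), $X_{k+1}:=X_k\times\dots\times X_k$ ($m$ factors). Maps $f_\alpha$. For $\alpha\in{}_1\Omega=\{1,\dots,n\}$, $f_\alpha:X_1\to X$ is the corresponding member of $\mathcal F$. For $\alpha=(\alpha^1,\dots,\alpha^{k+1})\in{}_{k+1}\Omega$, $f_\alpha:X_{k+1}\to X$ is $f_\alpha(x_1,\dots,x_m):=f_{\alpha^1}\left(f_{\alpha(1)}(x_1),\dots,f_{\alpha(m)}(x_m)\right)$ for $(x_1,\dots,x_m)\in X_k\times\dots\times X_k=X_{k+1}$. Coordinates. For $x\in X_1$, $x_{(1)},\dots,x_{(m)}\in X$ are its coordinates: $x=(x_{(1)},\dots,x_{(m)})$. For $x=(x_1,\dots,x_m)\in X_{k+1}=X_k\times\dots\times X_k$ and $(\epsilon_1,\dots,\epsilon_{k+1})\in\{1,\dots,m\}^{k+1}$, $x_{(\epsilon_1,\dots,\epsilon_{k+1})}:=(x_{\epsilon_1})_{(\epsilon_2,\dots,\epsilon_{k+1})}\in X$. In the same way, for $k\ge2$, $\beta\in\Omega_k$ and $(\epsilon_1,\dots,\epsilon_{k-1})\in\{1,\dots,m\}^{k-1}$, the element $\beta_{(\epsilon_1,\dots,\epsilon_{k-1})}\in\{1,\dots,n\}$ is defined: for $\beta=(\beta_1,\dots,\beta_m)\in\Omega_2$, $\beta_{(\epsilon_1)}:=\beta_{\epsilon_1}$; for $\beta=(\beta_1,\dots,\beta_m)\in\Omega_{k+1}$ with $k\ge 2$, $\beta_{(\epsilon_1,\dots,\epsilon_k)}:=(\beta_{\epsilon_1})_{(\epsilon_2,\dots,\epsilon_k)}$.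 In the claim, $\alpha^i_{(\epsilon_1,\dots,\epsilon_{i-1})}$ denotes $(\alpha^i)_{(\epsilon_1,\dots,\epsilon_{i-1})}$. For $k=1$ the formulas read $f_\alpha(x)=\sum_{\epsilon_1}A^{\alpha^1}_{\epsilon_1}\cdot x_{(\epsilon_1)}+B^\alpha$ and $B^\alpha=B^{\alpha^1}$. *)

(* Defs.v *)
(* Families indexed by {1,...,n} are 0-based: they are indexed by 'I_n. *)
From HB Require Import structures.
From mathcomp Require Import all_boot all_order all_algebra.
From mathcomp Require Import all_classical all_reals all_analysis.

Set Implicit Arguments.
Unset Strict Implicit.
Unset Printing Implicit Defensive.

Import Order.TTheory GRing.Theory Num.Theory.
Import numFieldNormedType.Exports.

Local Open Scope classical_set_scope.
Local Open Scope ring_scope.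

Definition euclid_dist (R : realType) (d : nat) (u v : 'cV[R]_d) : R :=
  Num.sqrt (\sum_(i < d) (u i 0 - v i 0) ^+ 2).

(* The default value 0 of the maximum is harmless since distances are >= 0. *)
Definition maxdist (R : realType) (X : Type) (dist : X -> X -> R) (m : nat)
    (x y : {ffun 'I_m -> X}) : R :=
  \big[Num.max/0]_(i < m) dist (x i) (y i).

(* Only the values of phi on [0, +oo[ are constrained. *)
Definition generalized_Matkowski (R : realType) (X : Type)
    (dist : X -> X -> R) (m : nat) (f : {ffun 'I_m -> X} -> X) : Prop :=
  exists phi : R -> R,
    [/\ forall t : R, 0 <= t -> 0 <= phi t,
        forall s t : R, 0 <= s -> s <= t -> phi s <= phi t,
        forall t : R, 0 < t -> iter k phi t @[k --> \oo] --> (0 : R) &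
        forall x y, dist (f x) (f y) <= phi (maxdist dist x y)].

Definition is_GIFS (R : realType) (X : Type) (dist : X -> X -> R) (m n : nat)
    (F : 'I_n -> {ffun 'I_m -> X} -> X) : Prop :=
  forall i : 'I_n, generalized_Matkowski dist (F i).

(* k-fold iteration of T |-> T^m, so that X_k = itpow m X k for k >= 1 and
   Omega_k.+1 = itpow m 'I_n k for k >= 0. *)
Fixpoint itpow (m : nat) (T : Type) (k : nat) : Type :=
  if k is k'.+1 then {ffun 'I_m -> itpow m T k'} else T.

Fixpoint itcoord (m : nat) (T : Type) (k : nat) :
    itpow m T k -> ('I_k -> 'I_m) -> T :=
  match k with
  | 0 => fun x _ => x
  | k'.+1 => fun x e => itcoord (x (e ord0)) (fun j : 'I_k' => e (lift ord0 j))
  end.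

(* The product Omega_1 x ... x Omega_k; alpha j stands for alpha^(j+1). *)
Definition gifs_code (m n k : nat) : Type := forall j : 'I_k, itpow m 'I_n j.

(* alpha(i) = (alpha^2_i, ..., alpha^k.+1_i); the type of alpha (lift ord0 j)
   is convertible to {ffun 'I_m -> itpow m 'I_n j}. *)
Definition subcode (m n k : nat) (alpha : gifs_code m n k.+1) (i : 'I_m) :
    gifs_code m n k :=
  fun j : 'I_k => (alpha (lift ord0 j) : itpow m 'I_n j.+1) i.

(* gifs_map F alpha is f_alpha for a code alpha of length k.+1. *)
Fixpoint gifs_map (X : Type) (m n : nat) (F : 'I_n -> {ffun 'I_m -> X} -> X)
    (k : nat) : gifs_code m n k.+1 -> itpow m X k.+1 -> X :=
  match k with
  | 0 => fun alpha x => F (alpha ord0) x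
  | k'.+1 => fun alpha x =>
      F (alpha ord0) [ffun i => gifs_map F (subcode alpha i) (x i)]
  end.

(* The ordered product of the l matrices
   A^(alpha^1)_(e_1), A^(alpha^2_(e_1))_(e_2), ...,
   A^(alpha^l_(e_1, ..., e_(l-1)))_(e_l), equal to 1 if l = 0. The factor of
   index j uses the prefix of length j of e. *)
Definition path_prod (R : realType) (d m n : nat)
    (A : 'I_n -> 'I_m -> 'M[R]_d) (k : nat) (alpha : gifs_code m n k) (l : nat)
    (le_lk : (l <= k)%N) (e : {ffun 'I_l -> 'I_m}) : 'M[R]_d :=
  \prod_(j < l)
    A (itcoord (alpha (widen_ord le_lk j))
         (fun i : 'I_j => e (widen_ord (ltnW (ltn_ord j)) i)))
      (e j).

(* B^alpha; the summand l = 0 is B^(alpha^1). *)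
Definition Bcode (R : realType) (d m n : nat) (A : 'I_n -> 'I_m -> 'M[R]_d)
    (B : 'I_n -> 'cV[R]_d) (k : nat) (alpha : gifs_code m n k) : 'cV[R]_d :=
  \sum_(l < k) \sum_(e : {ffun 'I_l -> 'I_m})
    path_prod A alpha (ltnW (ltn_ord l)) e *m B (itcoord (alpha l) e).

(* Main.v *)
Require Import Defs.
From HB Require Import structures.
From mathcomp Require Import all_boot all_order all_algebra.
From mathcomp Require Import all_classical all_reals all_analysis.

Set Implicit Arguments.
Unset Strict Implicit.
Unset Printing Implicit Defensive.

Import Order.TTheory GRing.Theory Num.Theory.
Import numFieldNormedType.Exports.

Local Open Scope classical_set_scope.
Local Open Scope ring_scope.

(** An affine map sends an affine expression to an affine expression, so the
    formula follows by unrolling the recursion that defines [gifs_map].  The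
    recursion peels off the first letter of a code: f_alpha applies
    F (alpha^1) to the values f_(alpha(i)) (x_i).  The right-hand side obeys the
    same recursion.  A word of length l.+1 is a first letter i followed by a
    word e of length l; along it, the matrix product for alpha is
    A^(alpha^1)_i times the product for alpha(i) along e ([path_prod_cons]),
    and the coordinate of x is the coordinate of x_i at e.  Splitting every sum
    over words according to the first letter ([big_word_recl]) and
    distributing A^(alpha^1)_i gives the recursion of the linear part and that
    of the constant part ([Bcode_recl]), hence of their sum
    ([code_affine_recl]).

    The right-hand side also makes sense for the empty code, where it is the
    identity.  The recursion thus holds from length 0 on, and the case k = 1 is
    one unrolling of it, like every induction step. *)

(** * Words split by their first letter *)

Definition word_cons (m l : nat) (i : 'I_m) (e : {ffun 'I_l -> 'I_m}) :
    {ffun 'I_l.+1 -> 'I_m} :=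
  [ffun j => if unlift ord0 j is Some j' then e j' else i].

Lemma word_cons0 (m l : nat) (i : 'I_m) (e : {ffun 'I_l -> 'I_m}) j :
  val j = 0%N -> word_cons i e j = i.
Proof.
by move=> j0; rewrite (_ : j = ord0) ?ffunE ?unlift_none //; apply: val_inj.
Qed.

Lemma word_consS (m l : nat) (i : 'I_m) (e : {ffun 'I_l -> 'I_m}) j j' :
  val j = (val j').+1 -> word_cons i e j = e j'.
Proof.
by move=> jS; rewrite (_ : j = lift ord0 j') ?ffunE ?liftK //; apply: val_inj.
Qed.

Lemma big_word_recl (V : nmodType) (m l : nat)
    (G : {ffun 'I_l.+1 -> 'I_m} -> V) :
  \sum_e G e = \sum_i \sum_e G (word_cons i e).
Proof.
rewrite pair_big /=.
pose uncons (e : {ffun 'I_l.+1 -> 'I_m}) :=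
  (e ord0, [ffun j : 'I_l => e (lift ord0 j)]).
rewrite (reindex (fun p : 'I_m * {ffun 'I_l -> 'I_m} => word_cons p.1 p.2)) //.
exists uncons => [[i e] _|e _] /=.
  rewrite /uncons word_cons0 //; congr pair.
  by apply/ffunP => j; rewrite ffunE (@word_consS _ _ _ _ _ j).
apply/ffunP => j; case: (unliftP ord0 j) => [j' ->|->].
  by rewrite (@word_consS _ _ _ _ _ j') // ffunE.
by rewrite word_cons0.
Qed.

Lemma big_word0 (V : nmodType) (m : nat) (G : {ffun 'I_0 -> 'I_m} -> V) e :
  \sum_e' G e' = G e.
Proof.
rewrite (bigD1 e) //= big1 ?addr0 // => e' /eqP[].
by apply/ffunP => -[].
Qed.

(** * Coordinates and matrix products along a nonempty word *)

Lemma eq_itcoord (m : nat) (T : Type) (k : nat) (x : itpow m T k)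
    (e e' : 'I_k -> 'I_m) : e =1 e' -> itcoord x e = itcoord x e'.
Proof. by move=> /funext ->. Qed.

Lemma itcoord_cons (m : nat) (T : Type) (k : nat) (x : itpow m T k.+1)
    (i : 'I_m) (e : {ffun 'I_k -> 'I_m}) :
  itcoord x (word_cons i e) = itcoord (x i) e.
Proof.
rewrite /= word_cons0 //; apply: eq_itcoord => j.
by rewrite (@word_consS _ _ _ _ _ j).
Qed.

(** Ordinals that differ only in their bound proofs index components of a code
    whose types are convertible but not syntactically equal.  Giving the index
    by its value j, with two arbitrary bound proofs, avoids any cast. *)
Lemma itcoord_subcode (m n k : nat) (alpha : gifs_code m n k.+1) (j : nat)
    (ltSjSk : (j.+1 < k.+1)%N) (ltjk : (j < k)%N)
    (e : 'I_j.+1 -> 'I_m) (e' : 'I_j -> 'I_m) (i : 'I_m) :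
  e ord0 = i -> (forall a, e (lift ord0 a) = e' a) ->
  itcoord (alpha (Ordinal ltSjSk)) e =
  itcoord (subcode alpha i (Ordinal ltjk)) e'.
Proof.
move=> <- ee' /=; rewrite /subcode (eq_itcoord _ ee').
rewrite /lift /=.
by rewrite (bool_irrelevance ltSjSk (@lift_subproof k.+1 0 (Ordinal ltjk))).
Qed.

(** The factor of index j.+1 for alpha reads alpha^(j+2) along i followed by a
    prefix of e, which by [itcoord_subcode] is alpha(i)^(j+1) along that
    prefix. *)
Lemma path_prod_cons (R : realType) (d m n : nat)
    (A : 'I_n -> 'I_m -> 'M[R]_d) (k : nat) (alpha : gifs_code m n k.+1)
    (l : nat) (leSlSk : (l.+1 <= k.+1)%N) (lelk : (l <= k)%N)
    (i : 'I_m) (e : {ffun 'I_l -> 'I_m}) :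
  path_prod A alpha leSlSk (word_cons i e) =
  A (alpha ord0) i *m path_prod A (subcode alpha i) lelk e.
Proof.
rewrite /path_prod big_ord_recl mulmxE; congr (_ * _).
  rewrite word_cons0 //; congr (A _ i).
  (* Only the bound proof of the index 0 differs between the two sides. *)
  rewrite /= /widen_ord /=.
  by rewrite (bool_irrelevance (widen_ord_proof ord0 leSlSk) (ltn0Sn k)).
apply: eq_bigr => j _; rewrite (@word_consS _ _ _ _ _ j) //; congr (A _ _).
apply: itcoord_subcode => [|a]; first by rewrite word_cons0.
exact: word_consS.
Qed.

(** * The recursion of the affine expression *)

(** The summand l = 0 is B^(alpha^1); in each later one the first matrix of the
    product factors out, leaving the summand l - 1 for alpha(i). *)
Lemma Bcode_recl (R : realType) (d m n : nat) (A : 'I_n -> 'I_m -> 'M[R]_d)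
    (B : 'I_n -> 'cV[R]_d) (k : nat) (alpha : gifs_code m n k.+1) :
  Bcode A B alpha =
  B (alpha ord0) + \sum_i A (alpha ord0) i *m Bcode A B (subcode alpha i).
Proof.
rewrite /Bcode big_ord_recl; congr (_ + _).
  rewrite (big_word0 _ (ffun0 (card_ord 0))).
  by rewrite /path_prod big_ord0 mul1mx.
under [RHS]eq_bigr do rewrite mulmx_sumr.
rewrite exchange_big; apply: eq_bigr => l _ /=.
rewrite big_word_recl; apply: eq_bigr => i _.
rewrite mulmx_sumr; apply: eq_bigr => e _.
rewrite (path_prod_cons _ _ _ (ltnW (ltn_ord l))) -mulmxA.
congr (_ *m (_ *m B _)).
case: l e => l ltlk e.
apply: itcoord_subcode => [|a]; first by rewrite word_cons0.
exact: word_consS.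
Qed.

(** Stated for every length k, including 0, so that a single recursion covers
    both the base case and the step of the induction on codes. *)
Definition code_affine (R : realType) (d m n : nat)
    (A : 'I_n -> 'I_m -> 'M[R]_d) (B : 'I_n -> 'cV[R]_d) (k : nat)
    (alpha : gifs_code m n k) (x : itpow m 'cV[R]_d k) : 'cV[R]_d :=
  \sum_(e : {ffun 'I_k -> 'I_m}) path_prod A alpha (leqnn k) e *m itcoord x e
  + Bcode A B alpha.

Lemma code_affine0 (R : realType) (d m n : nat)
    (A : 'I_n -> 'I_m -> 'M[R]_d) (B : 'I_n -> 'cV[R]_d)
    (alpha : gifs_code m n 0) (x : 'cV[R]_d) :
  @code_affine R d m n A B 0 alpha x = x.
Proof.
rewrite /code_affine /Bcode big_ord0 addr0.
rewrite (big_word0 _ (ffun0 (card_ord 0))).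
by rewrite /path_prod big_ord0 mul1mx.
Qed.

Lemma code_affine_recl (R : realType) (d m n : nat)
    (A : 'I_n -> 'I_m -> 'M[R]_d) (B : 'I_n -> 'cV[R]_d) (k : nat)
    (alpha : gifs_code m n k.+1) (x : itpow m 'cV[R]_d k.+1) :
  code_affine A B alpha x =
  \sum_i A (alpha ord0) i *m code_affine A B (subcode alpha i) (x i)
  + B (alpha ord0).
Proof.
rewrite /code_affine Bcode_recl big_word_recl.
under [in RHS]eq_bigr do rewrite mulmxDr mulmx_sumr.
rewrite big_split -addrA [B _ + _]addrC; congr (_ + _).
apply: eq_bigr => i _; apply: eq_bigr => e _.
by rewrite (path_prod_cons _ _ _ (leqnn k)) itcoord_cons mulmxA.
Qed.

Theorem theorem20 (R : realType) (d m n : nat)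
    (hd : (0 < d)%N) (hm : (0 < m)%N) (hn : (0 < n)%N)
    (F : 'I_n -> {ffun 'I_m -> 'cV[R]_d} -> 'cV[R]_d)
    (hGIFS : is_GIFS (@euclid_dist R d) F)
    (A : 'I_n -> 'I_m -> 'M[R]_d) (B : 'I_n -> 'cV[R]_d)
    (hF : forall (i : 'I_n) (x : {ffun 'I_m -> 'cV[R]_d}),
        F i x = \sum_(j < m) A i j *m x j + B i)
    (k : nat) (alpha : gifs_code m n k.+1) (x : itpow m 'cV[R]_d k.+1) :
  gifs_map F alpha x =
    \sum_(e : {ffun 'I_k.+1 -> 'I_m})
      path_prod A alpha (leqnn k.+1) e *m itcoord x e
    + Bcode A B alpha.
Proof.
rewrite -/(code_affine A B alpha x).
elim: k alpha x => [|k IHk] alpha x; rewrite code_affine_recl /= hF.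
  by congr (_ + _); apply: eq_bigr => i _; rewrite code_affine0.
by congr (_ + _); apply: eq_bigr => i _; rewrite ffunE IHk.
Qed.
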